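(* Let $\mathcal{X}$ be a real Banach space with $\dim(\mathcal{X})\ge 2$ and let $\kappa,\tau>0$. Write $m=\min\{\kappa,\tau\}$ and $M=\max\{\kappa,\tau\}$. Then $$[M\,\mathcal{T}(\mathcal{X})]^2-4M|\kappa-\tau|+(\kappa-\tau)^2\le \mathcal{T}_2(\kappa,\tau,\mathcal{X})^2\le [m\,\mathcal{T}(\mathcal{X})]^2+4m|\kappa-\tau|+(\kappa-\tau)^2.$$
   Context: $S_{\mathcal{X}}$ denotes the unit sphere of $\mathcal{X}$. Define $$\mathcal{T}(\mathcal{X})=\sup_{x_1,x_2\in S_{\mathcal{X}}}\big(\|x_1+x_2\|\,\|x_1-x_2\|\big)^{1/2},$$ and, for $\kappa,\tau>0$, $$\mathcal{T}_2(\kappa,\tau,\mathcal{X})=\sup_{x_1,x_2\in S_{\mathcal{X}}}\big(\|\kappa x_1+\tau x_2\|\,\|\tau x_1-\kappa x_2\|\big)^{1/2}.$$ *)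

(* Defs.v *)
From HB Require Import structures.
From mathcomp Require Import all_boot all_order all_algebra.
From mathcomp Require Import all_classical all_reals all_analysis.

Set Implicit Arguments.
Unset Strict Implicit.
Unset Printing Implicit Defensive.

Import Order.TTheory GRing.Theory Num.Theory.
Import numFieldNormedType.Exports.

Local Open Scope classical_set_scope.
Local Open Scope ring_scope.

(* [vector.free] and [\dim] require a finite-dimensional [vectType], whereas
   the spaces here may be infinite-dimensional, hence this formulation by
   linearly independent families. *)
Definition lin_indep (R : realType) (X : lmodType R) (n : nat)
    (v : 'I_n -> X) : Prop :=
  forall c : 'I_n -> R, \sum_(i < n) c i *: v i = 0 -> forall i, c i = 0.

Definition dim_ge (R : realType) (X : lmodType R) (n : nat) : Prop :=
  exists v : 'I_n -> X, lin_indep v.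
Arguments dim_ge {R} X n.

Definition unit_sphere (R : realType) (X : normedModType R) : set X :=
  [set x | `|x| = 1].
Arguments unit_sphere {R} X _.

(* The real-valued [sup] is a junk value on empty or unbounded sets. The two
   sets below are nonempty as soon as X is nonzero, and they are bounded,
   respectively by 2 and by `|k| + `|t|. *)
Definition constT (R : realType) (X : normedModType R) : R :=
  sup [set Num.sqrt (`|x1 + x2| * `|x1 - x2|)
      | x1 in unit_sphere X & x2 in unit_sphere X].

Definition constT2 (R : realType) (k t : R) (X : normedModType R) : R :=
  sup [set Num.sqrt (`|k *: x1 + t *: x2| * `|t *: x1 - k *: x2|)
      | x1 in unit_sphere X & x2 in unit_sphere X].

(* Main.v *)
Require Import Defs.
From HB Require Import structures.
From mathcomp Require Import all_boot all_order all_algebra.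
From mathcomp Require Import all_classical all_reals all_analysis.
From mathcomp Require Import lra.

Import Order.TTheory GRing.Theory Num.Theory.
Import numFieldNormedType.Exports.

Local Open Scope ring_scope.

(** Squaring removes the square roots from both suprema, so everything reduces
    to comparing, for unit vectors [x] and [y], the product of the norms of
    [k *: x + t *: y] and [t *: x - k *: y] with the product of
    [p = `|x + y|] and [q = `|x - y|].

    Replacing both coefficients of [k *: x + t *: y] by a common [c >= 0]
    changes the norm by at most [`|k - c| + `|t - c|]
    ([dist_norm_lincomb_unit]), and for [c = Num.min k t] as well as for
    [c = Num.max k t] this error is exactly [d = `|k - t|].  Hence, with
    [m] the minimum and [M] the maximum, the two norms are at most [m p + d]
    and [m q + d], and at least [M p - d] and [M q - d].  Multiplying out and
    using [p + q <= 4] yields both inequalities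
    ([prod_norm_unit_le], [prod_norm_unit_ge]).

    The one delicate point is multiplying the lower bounds, which may be
    negative.  They cannot both be: [p + q >= `|2 x| = 2] whereas [d <= M]. *)

Set Implicit Arguments.
Unset Strict Implicit.

Section SupSqrt.
Variables (R : realType) (T U : Type) (A : set T) (B : set U) (f : T -> U -> R).

Let S : set R := [set Num.sqrt (f x y) | x in A & y in B]%classic.

(** The assumption [0 <= c] takes care of the empty family, whose supremum
    is 0. *)
Lemma sqr_sup_sqrt_le (c : R) : 0 <= c ->
  (forall x y, A x -> B y -> f x y <= c) -> sup S ^+ 2 <= c.
Proof.
move=> c0 fc.
have [S0|/set0P/[dup] Sn0 [_ [x Ax [y By _]]]] := eqVneq S set0.
  by rewrite S0 sup0 expr0n.
have ubS : ubound S (Num.sqrt c).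
  by move=> _ [x' Ax' [y' By' <-]]; apply: ler_wsqrtr; exact: fc.
have sup_ge0 : 0 <= sup S.
  apply: le_trans (sqrtr_ge0 (f x y)) _; apply: ub_le_sup.
    by exists (Num.sqrt c).
  by exists x => //; exists y.
rewrite -[leRHS]sqr_sqrtr// ler_sqr ?nnegrE ?sqrtr_ge0//.
exact: ge_sup.
Qed.

Lemma le_sqr_sup_sqrt (c : R) (x : T) (y : U) :
  (forall x y, A x -> B y -> f x y <= c) ->
  A x -> B y -> 0 <= f x y -> f x y <= sup S ^+ 2.
Proof.
move=> fc Ax By f0.
have sqrt_le : Num.sqrt (f x y) <= sup S.
  apply: ub_le_sup; last by exists x => //; exists y.
  exists (Num.sqrt c) => _ [x' Ax' [y' By' <-]].
  by apply: ler_wsqrtr; exact: fc.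
rewrite -[leLHS]sqr_sqrtr// ler_sqr ?nnegrE ?sqrtr_ge0//.
exact: le_trans (sqrtr_ge0 _) sqrt_le.
Qed.

End SupSqrt.

Section UnitVectors.
Variables (R : realType) (X : normedModType R).
Implicit Types (x y : X) (a b c k t : R).

Lemma norm_lincomb_unit_le a b x y : `|x| = 1 -> `|y| = 1 ->
  `|a *: x + b *: y| <= `|a| + `|b|.
Proof.
by move=> x1 y1; rewrite (le_trans (ler_normD _ _))// !normrZ x1 y1 !mulr1.
Qed.

Lemma dist_norm_lincomb_unit a b c x y : 0 <= c -> `|x| = 1 -> `|y| = 1 ->
  `| `|a *: x + b *: y| - c * `|x + y| | <= `|a - c| + `|b - c|.
Proof.
move=> c0 x1 y1; rewrite -[in c * _](ger0_norm c0) -normrZ.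
apply: le_trans (ler_dist_dist _ _) _.
rewrite scalerDr opprD addrACA -!scalerBl.
exact: norm_lincomb_unit_le.
Qed.

(** The second norm is an instance of the same bound, with the coefficients
    exchanged and [y] replaced by its opposite. *)
Lemma dist_norm_lincomb_pair k t c x y : 0 <= c -> `|x| = 1 -> `|y| = 1 ->
  `| `|k *: x + t *: y| - c * `|x + y| | <= `|k - c| + `|t - c| /\
  `| `|t *: x - k *: y| - c * `|x - y| | <= `|k - c| + `|t - c|.
Proof.
move=> c0 x1 y1; split; first exact: dist_norm_lincomb_unit.
by rewrite [leRHS]addrC -scalerN; apply: dist_norm_lincomb_unit; rewrite ?normrN.
Qed.

Lemma distr_min k t : `|k - Num.min k t| + `|t - Num.min k t| = `|k - t|.
Proof. by case: leP => _; rewrite subrr normr0 ?add0r ?addr0// distrC. Qed.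

Lemma distr_max k t : `|k - Num.max k t| + `|t - Num.max k t| = `|k - t|.
Proof. by case: leP => _; rewrite subrr normr0 ?add0r ?addr0// distrC. Qed.

Lemma normD_normB_unit_le4 x y : `|x| = 1 -> `|y| = 1 ->
  `|x + y| + `|x - y| <= 4.
Proof.
move=> x1 y1; have := ler_normD x y; have := ler_normB x y.
by rewrite x1 y1; lra.
Qed.

Lemma normD_normB_unit_ge2 x y : `|x| = 1 -> 2 <= `|x + y| + `|x - y|.
Proof.
move=> x1; apply: le_trans (ler_normD _ _).
by rewrite addrACA subrr addr0 -mulr2n normrMn x1.
Qed.

Lemma prod_norm_unit_le k t x y : 0 < k -> 0 < t -> `|x| = 1 -> `|y| = 1 ->
  `|k *: x + t *: y| * `|t *: x - k *: y| <=
  Num.min k t ^+ 2 * (`|x + y| * `|x - y|) + 4 * Num.min k t * `|k - t|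
    + (k - t) ^+ 2.
Proof.
move=> k0 t0 x1 y1; have m0 : 0 <= Num.min k t by rewrite le_min !ltW.
have [] := dist_norm_lincomb_pair k t m0 x1 y1.
rewrite distr_min !ler_norml => /andP[_ pd] /andP[_ qd].
have pq4 := normD_normB_unit_le4 x1 y1.
rewrite -[in leRHS](@real_normK _ (k - t)) ?num_real//.
move: (Num.min k t) (`|k - t|) (normr_ge0 (k - t)) m0 pd qd pq4.
move=> m d d0 m0 pd qd pq4.
have md0 : 0 <= m * d by rewrite mulr_ge0.
have ab : `|k *: x + t *: y| * `|t *: x - k *: y| <=
    (m * `|x + y| + d) * (m * `|x - y| + d).
  by apply: ler_pM => //; lra.
have := ler_wpM2l md0 pq4; lra.
Qed.

Lemma prod_norm_unit_ge k t x y : 0 < k -> 0 < t -> `|x| = 1 -> `|y| = 1 ->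
  Num.max k t ^+ 2 * (`|x + y| * `|x - y|) - 4 * Num.max k t * `|k - t|
    + (k - t) ^+ 2 <= `|k *: x + t *: y| * `|t *: x - k *: y|.
Proof.
move=> k0 t0 x1 y1; have M0 : 0 <= Num.max k t by rewrite le_max ltW.
have dM : `|k - t| <= Num.max k t.
  by rewrite ler_norml; case: (leP k t) => kt; apply/andP; split; lra.
have [] := dist_norm_lincomb_pair k t M0 x1 y1.
rewrite distr_max !ler_norml => /andP[pd _] /andP[qd _].
have pq4 := normD_normB_unit_le4 x1 y1.
have pq2 := normD_normB_unit_ge2 y x1.
rewrite -[in leLHS](@real_normK _ (k - t)) ?num_real//.
move: (Num.max k t) (`|k - t|) (normr_ge0 (k - t)) M0 dM pd qd.
move=> M d d0 M0 dM pd qd.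
have Md0 : 0 <= M * d by rewrite mulr_ge0.
have Mpq4 := ler_wpM2l Md0 pq4.
have Mpq2 := ler_wpM2l M0 pq2.
suff : (M * `|x + y| - d) * (M * `|x - y| - d) <=
    `|k *: x + t *: y| * `|t *: x - k *: y| by lra.
have [u0|u0] := leP 0 (M * `|x + y| - d); have [v0|v0] := leP 0 (M * `|x - y| - d).
- by apply: ler_pM => //; lra.
- by apply: (@le_trans _ _ 0); rewrite ?mulr_ge0 ?mulr_ge0_le0// ltW.
- by apply: (@le_trans _ _ 0); rewrite ?mulr_ge0 ?mulr_le0_ge0// ltW.
- (* Both factors negative would give 2 M <= M (p + q) < 2 d <= 2 M. *)
  by exfalso; lra.
Qed.

Lemma normD_normB_le_sqr_constT x y : `|x| = 1 -> `|y| = 1 ->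
  `|x + y| * `|x - y| <= constT X ^+ 2.
Proof.
move=> x1 y1; apply: (@le_sqr_sup_sqrt _ _ _ _ _
  (fun x y : X => `|x + y| * `|x - y|) (2 * 2)); rewrite ?mulr_ge0//.
move=> x' y' x1' y1'; apply: ler_pM => //.
  by rewrite (le_trans (ler_normD _ _))// x1' y1'; lra.
by rewrite (le_trans (ler_normB _ _))// x1' y1'; lra.
Qed.

Lemma prod_norm_le_sqr_constT2 k t x y : `|x| = 1 -> `|y| = 1 ->
  `|k *: x + t *: y| * `|t *: x - k *: y| <= constT2 k t X ^+ 2.
Proof.
move=> x1 y1; apply: (@le_sqr_sup_sqrt _ _ _ _ _
  (fun x y : X => `|k *: x + t *: y| * `|t *: x - k *: y|)
  ((`|k| + `|t|) * (`|t| + `|k|))); rewrite ?mulr_ge0//.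
move=> x' y' x1' y1'; apply: ler_pM => //.
  exact: norm_lincomb_unit_le.
by rewrite -scalerN; apply: norm_lincomb_unit_le; rewrite ?normrN.
Qed.

End UnitVectors.

Unset Implicit Arguments.
Set Strict Implicit.

Theorem theorem5 (R : realType) (X : completeNormedModType R)
    (hdim : dim_ge X 2) (k t : R) (hk : 0 < k) (ht : 0 < t) :
  let m := Num.min k t in
  let M := Num.max k t in
  (M * constT X) ^+ 2 - 4 * M * `|k - t| + (k - t) ^+ 2
    <= constT2 k t X ^+ 2
  /\ constT2 k t X ^+ 2
    <= (m * constT X) ^+ 2 + 4 * m * `|k - t| + (k - t) ^+ 2.
Proof.
move=> m M.
have m0 : 0 < m by rewrite lt_min hk.
have M0 : 0 < M by rewrite lt_max hk.
rewrite !exprMn; split.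
- (* Solved for [constT X ^+ 2], the inequality bounds a supremum from above. *)
  suff : constT X ^+ 2 <=
      (constT2 k t X ^+ 2 + 4 * M * `|k - t| - (k - t) ^+ 2) / M ^+ 2.
    by rewrite ler_pdivlMr ?exprn_gt0//; lra.
  apply: sqr_sup_sqrt_le => [|x y x1 y1].
    have dM : `|k - t| <= M.
      by rewrite ler_norml /M; case: (leP k t) => kt; apply/andP; split; lra.
    have d2 : (k - t) ^+ 2 <= M * `|k - t|.
      by rewrite -real_normK ?num_real// expr2 ler_wpM2r.
    have Md0 : 0 <= M * `|k - t| by rewrite mulr_ge0// ltW.
    have T0 := sqr_ge0 (constT2 k t X).
    by rewrite divr_ge0 ?exprn_ge0 ?(ltW M0)//; lra.
  rewrite ler_pdivlMr ?exprn_gt0//.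
  have := prod_norm_unit_ge hk ht x1 y1.
  by have := prod_norm_le_sqr_constT2 k t x1 y1; rewrite -/M; lra.
- apply: sqr_sup_sqrt_le => [|x y x1 y1].
    have md0 : 0 <= m * `|k - t| by rewrite mulr_ge0// ltW.
    have mT0 : 0 <= m ^+ 2 * constT X ^+ 2 by rewrite mulr_ge0 ?sqr_ge0.
    by have := sqr_ge0 (k - t); lra.
  apply: le_trans (prod_norm_unit_le hk ht x1 y1) _.
  by rewrite !lerD2r ler_wpM2l ?sqr_ge0// normD_normB_le_sqr_constT.
Qed.
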